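(* Let $r\in(0,\infty)$ and $\alpha\in[0,m]$. Then the set $\mathcal{S}_\alpha:=\{\vartheta\in\Omega(\mathbb{R}^m):D_r(\vartheta)=\alpha\}$ is a dense subset of $\Omega(\mathbb{R}^m)$ with respect to $d_L$.
   Context: $\Omega(\mathbb{R}^m)$ is the set of all Borel probability measures on $\mathbb{R}^m$ (with the Euclidean norm), endowed with $$d_L(\vartheta,\theta)=\sup_{h\in\mathrm{Lip}_1(\mathbb{R}^m)}\Big|\int_{\mathbb{R}^m}h\,d\vartheta-\int_{\mathbb{R}^m}h\,d\theta\Big|,$$ where $\mathrm{Lip}_1(\mathbb{R}^m)$ is the set of Lipschitz functions $h:\mathbb{R}^m\to\mathbb{R}$ with Lipschitz constant at most $1$. For $r\in(0,\infty)$ and $n\in\mathbb{N}$, the $n$th quantization error of order $r$ of $\vartheta$ is $$V_{n,r}(\vartheta)=\inf\Big\{\int d(x,A)^r\,d\vartheta(x):A\subset\mathbb{R}^m,\ \mathrm{Card}(A)\le n\Big\},$$ with $d(x,A)$ the Euclidean distance from $x$ to $A$ ($A$ nonempty). The quantization dimension of order $r$ is $D_r(\vartheta)=\lim_{n\to\infty}\frac{r\log n}{-\log V_{n,r}(\vartheta)}$ when this limit exists; the quotient is taken to be $0$ when $V_{n,r}(\vartheta)=0$, so finitely supported measures have quantization dimension $0$. The condition $D_r(\vartheta)=\alpha$ means that the limit exists and equals $\alpha$.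
   Formalization: Here Ω(ℝ^m) is restricted to the Borel probability measures with finite first moment, since d_L is not well defined for measures with infinite first moment. *)

(* Defs.v *)
From mathcomp Require Import all_boot all_order all_algebra.
From mathcomp Require Import all_classical all_reals all_analysis.

Set Implicit Arguments.
Unset Strict Implicit.
Unset Printing Implicit Defensive.

Import Order.TTheory GRing.Theory Num.Theory.
Import numFieldNormedType.Exports.

Local Open Scope classical_set_scope.
Local Open Scope card_scope.
Local Open Scope ring_scope.

(* R^m with its Borel sigma-algebra. The library norm on row vectors is the
   sup norm, but its open sets are those of the Euclidean norm [enorm] below,
   which is the one used for every metric notion in this file. *)
Notation borelRV R m := (g_sigma_algebraType (@open 'rV[R]_m)).

Definition enorm (R : realType) (m : nat) (x : 'rV[R]_m) : R :=
  Num.sqrt (\sum_(i < m) x ord0 i ^+ 2).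

Definition Lip1 (R : realType) (m : nat) : set ('rV[R]_m -> R) :=
  [set h | forall x y, `|h x - h y| <= enorm (x - y)].

(* The integrals of 1-Lipschitz functions, hence d_L, make sense exactly for the
   probability measures with finite first moment; on these d_L is a finite
   metric. If the first moment of theta is infinite, the truncations of enorm
   put theta at infinite distance from every measure with finite first moment. *)
Definition Omega (R : realType) (m : nat) : set (probability (borelRV R m) R) :=
  [set theta : probability (borelRV R m) R |
    (\int[theta]_x (enorm (x : borelRV R m))%:E < +oo)%E].

Definition d_L (R : realType) (m : nat)
    (vartheta theta : probability (borelRV R m) R) : \bar R :=
  ereal_sup [set `| \int[vartheta]_x (h (x : borelRV R m))%:E
               - \int[theta]_x (h (x : borelRV R m))%:E |%E
             | h in @Lip1 R m].

Definition dist_set (R : realType) (m : nat) (A : set 'rV[R]_m) (x : 'rV[R]_m) : R :=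
  inf [set enorm (x - a) | a in A].

Definition quant_error (R : realType) (m : nat) (n : nat) (r : R)
    (theta : probability (borelRV R m) R) : \bar R :=
  ereal_inf [set (\int[theta]_x (dist_set A (x : borelRV R m) `^ r)%:E)%E
            | A in [set A : set 'rV[R]_m | A !=set0 /\ A #<= `I_n]].

(* Extended-real arithmetic: if V_{n,r} = 0 the denominator is +oo and the
   quotient is 0; if V_{n,r} = +oo (infinite r-th moment) the denominator and,
   for n > 1, the quotient are -oo, so no limit in [0, +oo[ arises that way. *)
Definition quant_quotient (R : realType) (m : nat) (r : R)
    (theta : probability (borelRV R m) R) (n : nat) : \bar R :=
  ((r * ln n%:R)%:E / - lne (quant_error n r theta))%E.

Definition has_quant_dim (R : realType) (m : nat) (r : R)
    (theta : probability (borelRV R m) R) (alpha : R) : Prop :=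
  quant_quotient r theta n @[n --> \oo] --> alpha%:E.

Definition S_ (R : realType) (m : nat) (r alpha : R) :
    set (probability (borelRV R m) R) :=
  [set theta : probability (borelRV R m) R |
    Omega theta /\ has_quant_dim r theta alpha].

Definition d_L_dense (R : realType) (m : nat)
    (S : set (probability (borelRV R m) R)) : Prop :=
  S `<=` @Omega R m /\
  forall theta, Omega theta -> forall eps : R, 0 < eps ->
    exists2 vartheta, S vartheta & (d_L vartheta theta < eps%:E)%E.

(* Main.v *)
(* Take measures (1 - e) P + e mu, where P is the image of
   theta under a nearest-point map onto finitely many points, so that
   d_L(P, theta) is small, and mu is a boundedly supported measure of dimension
   alpha. The finite support of P only shifts n by a constant in the
   quantization errors, and the factor e disappears in the logarithm, so the
   mixture has the dimension of mu; it tends to P in d_L as e tends to 0.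

   For mu one can take a discrete measure. With s = 2^(-m/alpha) <= 1/2, let
   G_j = s^j {0, ..., 2^j - 1}^m and let mu be the sum over j of w_j times the
   uniform measure on G_j, where w_j = 1/((j+1)(j+2)). The points of
   G_0, ..., G_J are at distance at most m s^J from every other point of the
   support, and there are about 2^(m J) of them; conversely at most half of
   G_j can be close to a set of 2^(m j)/2 points, which bounds the error below
   by a constant times w_j s^(j r). As w_j decays subexponentially, both bounds
   give the exponent r/alpha. For alpha = 0 the measure P itself is enough. *)
From HB Require Import structures.
Require Import Defs.
From mathcomp Require Import all_boot all_order all_algebra.
From mathcomp Require Import all_classical all_reals all_analysis.
From mathcomp Require Import measurable_realfun.
From mathcomp Require Import lra ring zify.

Set Implicit Arguments.
Unset Strict Implicit.
Unset Printing Implicit Defensive.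

Import Order.TTheory GRing.Theory Num.Theory.
Import numFieldNormedType.Exports.

Local Open Scope classical_set_scope.
Local Open Scope card_scope.
Local Open Scope ring_scope.

(** * Euclidean norm and distance to a set: estimates, continuity, measurability *)

Section EuclideanNorm.
Context {R : realType} {m : nat}.
Implicit Types (x y : 'rV[R]_m) (A : set 'rV[R]_m).

Lemma enorm_ge0 x : 0 <= enorm x.
Proof. exact: sqrtr_ge0. Qed.

Lemma enorm0 : enorm (0 : 'rV[R]_m) = 0.
Proof.
by rewrite /enorm big1 ?sqrtr0// => i _; rewrite mxE expr0n.
Qed.

Lemma coord_le_enorm x (i : 'I_m) : `|x ord0 i| <= enorm x.
Proof.
rewrite -sqrtr_sqr ler_wsqrtr// (bigD1 i)//= lerDl sumr_ge0// => j _.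
exact: sqr_ge0.
Qed.

(** The factor [m], rather than its square root, comes from [m <= m ^ 2]; constants do not affect
    the exponents sought. *)
Lemma enorm_le_coord x (c : R) : 0 <= c -> (forall i, `|x ord0 i| <= c) ->
  enorm x <= m%:R * c.
Proof.
move=> c0 xc; rewrite -[leRHS]ger0_norm ?mulr_ge0// -sqrtr_sqr ler_wsqrtr//.
have xc2 : \sum_(i < m) x ord0 i ^+ 2 <= \sum_(i < m) c ^+ 2.
  by apply: ler_sum => i _; rewrite -real_normK ?num_real// lerXn2r// nnegrE.
rewrite (le_trans xc2)// sumr_const card_ord -[leLHS]mulr_natl exprMn.
rewrite -natrX.
apply: ler_wpM2r; rewrite ?sqr_ge0// ler_nat.
by case: (m) => // k; rewrite expnS leq_pmulr.
Qed.

Lemma enorm_continuous : continuous (@enorm R m).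
Proof.
move=> x; apply: (@continuous_comp _ _ _ (fun y : 'rV[R]_m =>
  \sum_(i < m) y ord0 i ^+ 2)); last exact: sqrt_continuous.
move: x; apply: continuous_big => [|i _ x]; first exact: add_continuous.
apply: (@continuous_comp _ _ _ (fun y : 'rV[R]_m => y ord0 i) (fun z => z ^+ 2)).
  exact: coord_continuous.
exact: exprn_continuous.
Qed.

Lemma enorm_subr_continuous (a : 'rV[R]_m) :
  continuous (fun x : 'rV[R]_m => enorm (x - a)).
Proof.
move=> x; apply: (@continuous_comp _ _ _ (fun x => x - a));
  last exact: enorm_continuous.
by apply: (@cvgB _ 'rV[R]_m _ (nbhs x));
  [exact: (@cvg_id 'rV[R]_m)|exact: (@cvg_cst 'rV[R]_m)].
Qed.

(** Open left rays generate the Borel sets of the line, so upper semicontinuity suffices; this form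
    suits [dist_set], an infimum. *)
Lemma open_lt_measurable (f : 'rV[R]_m -> R) :
  (forall c, open [set x | f x < c]) ->
  measurable_fun setT (f : borelRV R m -> R).
Proof.
move=> of_; apply: (measurability _ (RGenInftyO.measurableE R)) => _ [_ [c ->] <-].
rewrite setTI; apply: sub_sigma_algebra.
rewrite (_ : _ @^-1` _ = [set x | f x < c])//.
Qed.

Lemma continuous_borel_measurable (f : 'rV[R]_m -> R) :
  continuous f -> measurable_fun setT (f : borelRV R m -> R).
Proof.
move=> cf; apply: open_lt_measurable => c.
rewrite (_ : [set x | f x < c] = f @^-1` [set y | y < c])//.
by apply: open_comp => [x _|]; [exact: cf|exact: open_lt].
Qed.

Lemma Lip1_continuous (h : 'rV[R]_m -> R) : Lip1 h -> continuous h.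
Proof.
move=> hL x; apply/(@cvgrPdist_lt _ _ _ (nbhs x) (nbhs_filter x)) => e e0.
have m0 : 0 < m%:R + 1 :> R by rewrite ltr_wpDl.
(* The neighbourhood is a sup-norm ball; the [+ 1] keeps the radius positive for [m = 0] and makes
   the final inequality strict. *)
apply/(@nbhs_normP _ 'rV[R]_m x); exists (e / (m%:R + 1)) => [|y xy] /=.
  by rewrite divr_gt0.
rewrite (le_lt_trans (hL _ _))//.
rewrite (@le_lt_trans _ _ (m%:R * (e / (m%:R + 1))))//.
  apply: enorm_le_coord => [|i]; first by rewrite divr_ge0 ?ltW.
  by rewrite (le_trans _ (ltW xy))// [`|x - y|]mx_normrE (le_bigmax _ _ (ord0, i)).
by rewrite mulrCA gtr_pMr// ltr_pdivrMr// mul1r ltrDl.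
Qed.

Lemma enorm_has_inf A x : A !=set0 -> has_inf [set enorm (x - a) | a in A].
Proof.
move=> [a Aa]; split; first by exists (enorm (x - a)), a.
by exists 0 => _ [b _ <-]; exact: enorm_ge0.
Qed.

Lemma dist_set_ge0 A x : 0 <= dist_set A x.
Proof.
have [->|/set0P A0] := eqVneq A set0; first by rewrite /dist_set image_set0 inf0.
apply: lb_le_inf; first by have [] := enorm_has_inf x A0.
by move=> _ [b _ <-]; exact: enorm_ge0.
Qed.

Lemma dist_set_le A x a : A a -> dist_set A x <= enorm (x - a).
Proof.
move=> Aa; apply: ge_inf; last by exists a.
by case: (enorm_has_inf x (ex_intro _ _ Aa)).
Qed.

Lemma dist_set_mem A a : A a -> dist_set A a = 0.
Proof.
move=> Aa; apply/le_anti; rewrite dist_set_ge0 andbT.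
by rewrite (le_trans (dist_set_le _ Aa))// subrr enorm0.
Qed.

Lemma dist_set_lt A x c : A !=set0 -> dist_set A x < c ->
  exists2 a, A a & enorm (x - a) < c.
Proof.
move=> A0 /inf_lt[|_ [a Aa <-]]; last by exists a.
by case: (enorm_has_inf x A0).
Qed.

Lemma dist_set_measurable A : A !=set0 ->
  measurable_fun setT (dist_set A : borelRV R m -> R).
Proof.
move=> A0; apply: open_lt_measurable => c.
(* [A] may be uncountable, so the sublevel set is shown to be open, as a union of open balls. *)
rewrite (_ : [set x | _] = \bigcup_(a in A) [set x | enorm (x - a) < c]).
  apply: bigcup_open => a _.
  rewrite (_ : [set x | _] = (fun x => enorm (x - a)) @^-1` [set y | y < c])//.
  apply: open_comp => [x _|]; last exact: open_lt.
  exact: enorm_subr_continuous.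
apply/seteqP; split => x /= => [/(dist_set_lt A0)[a]|[a Aa xa]].
  by exists a.
by rewrite (le_lt_trans (dist_set_le _ Aa)).
Qed.

Lemma dist_powR_measurable A (r : R) : A !=set0 ->
  measurable_fun setT
    ((fun x => (dist_set A x `^ r)%:E) : borelRV R m -> \bar R).
Proof.
move=> A0; apply/measurable_EFinP.
exact: (measurableT_comp (measurable_powR r) (dist_set_measurable A0)).
Qed.

End EuclideanNorm.

(** * Mixtures of probability measures, described by integrals of nonnegative functions *)

Section Mixtures.
Local Open Scope ereal_scope.
Context d (T : measurableType d) (R : realType).

Section UnitMass.
Variables (mu : {measure set T -> \bar R}) (mu1 : mu setT = 1).

(** An alias of [mu] that carries the proof of total mass 1, so that the probability structure can
    be attached to it. *)
Definition unit_mass of mu setT = 1 : set T -> \bar R := mu.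

HB.instance Definition _ := Measure.copy (unit_mass mu1) mu.

HB.instance Definition _ := Measure_isProbability.Build _ _ _ (unit_mass mu1) mu1.

End UnitMass.

Lemma mixture_exists (w : nat -> R) (P : nat -> probability T R) :
  (forall n, 0 <= w n)%R -> \sum_(n <oo) (w n)%:E = 1 ->
  exists Q : probability T R, forall f : T -> \bar R,
    measurable_fun setT f -> (forall x, 0 <= f x) ->
    \int[Q]_x f x = \sum_(n <oo) (w n)%:E * \int[P n]_x f x.
Proof.
move=> w0 w1; pose M n : measure T R := mscale (NngNum (w0 n)) (P n).
pose mu : measure T R := mseries M 0.
have mu1 : mu setT = 1.
  rewrite /mu/= /mseries -w1; apply: eq_eseriesr => n _.
  by rewrite (_ : M n setT = (w n)%:E * P n setT)// probability_setT mule1.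
exists (unit_mass mu1) => f mf f0.
rewrite (_ : \int[_]_x f x = \int[mu]_x f x)//.
rewrite ge0_integral_measure_series//; apply: eq_eseriesr => n _.
by rewrite ge0_integral_mscale.
Qed.

Lemma convex_combination_exists (P Q : probability T R) (e : R) :
  (0 <= e <= 1)%R ->
  exists M : probability T R, forall f : T -> \bar R,
    measurable_fun setT f -> (forall x, 0 <= f x) ->
    \int[M]_x f x = (1 - e)%:E * \int[P]_x f x + e%:E * \int[Q]_x f x.
Proof.
move=> /andP[e0 e1]; have e1' : (0 <= 1 - e)%R by rewrite subr_ge0.
pose mu : measure T R :=
  measure_add (mscale (NngNum e1') P) (mscale (NngNum e0) Q).
have mu1 : mu setT = 1.
  rewrite (_ : mu setT = (1 - e)%:E * P setT + e%:E * Q setT); last first.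
    exact: measure_addE.
  by rewrite !probability_setT !mule1 -EFinD subrK.
exists (unit_mass mu1) => f mf f0.
rewrite (_ : \int[_]_x f x = \int[mu]_x f x)//.
by rewrite ge0_integral_measure_add// !ge0_integral_mscale.
Qed.

Lemma uniform_exists (s : seq T) : s != [::] ->
  exists Q : probability T R, forall f : T -> \bar R,
    measurable_fun setT f -> (forall x, 0 <= f x) ->
    \int[Q]_x f x = ((size s)%:R^-1)%:E * \sum_(x <- s) f x.
Proof.
case: s => // a s _; set s' := a :: s; set N := size s'.
have N0 : (0 < N%:R :> R)%R by rewrite ltr0n.
(* The finite average is a countable mixture of Dirac masses whose weights vanish from index [N]
   on. *)
pose w n : R := if (n < N)%N then (N%:R^-1)%R else 0%R.
have w0 n : (0 <= w n)%R by rewrite /w; case: ifP => // _; rewrite invr_ge0 ltW.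
have sumw (F : nat -> \bar R) : (forall n, 0 <= F n) ->
    \sum_(n <oo) (w n)%:E * F n = \sum_(0 <= n < N) (N%:R^-1)%:E * F n.
  move=> F0; rewrite (nneseries_split 0 N)//; last first.
    by move=> n _; rewrite mule_ge0// lee_fin.
  rewrite add0n [X in _ + X]eseries0 ?adde0; last first.
    by move=> n Nn _; rewrite /w ltnNge Nn mul0e.
  by apply: eq_big_nat => n /andP[_ nN]; rewrite /w nN.
have [|Q QE] := @mixture_exists w (fun n => \d_(nth a s' n)) w0.
  transitivity (\sum_(n <oo) (w n)%:E * 1 : \bar R).
    by apply: eq_eseriesr => n _; rewrite mule1.
  rewrite sumw// big_mkord; under eq_bigr do rewrite mule1.
  by rewrite sumEFin sumr_const card_ord -[X in X%:E]mulr_natl divff// gt_eqF.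
exists Q => f mf f0; rewrite QE//.
under eq_eseriesr do rewrite integral_dirac// diracT mul1e.
rewrite sumw// -ge0_sume_distrr//.
by rewrite (big_nth a) big_mkord.
Qed.
End Mixtures.

(** * Nearest-point maps onto finitely many points *)

Section NearestPoint.
Context {R : realType} {m : nat}.
Implicit Types (x : 'rV[R]_m) (q : nat -> 'rV[R]_m).

(** Starting from the candidate [0] keeps the displacement below [enorm x], which is integrable for
    measures in [Omega]. *)
Fixpoint nearest q (N : nat) x : 'rV[R]_m :=
  if N is N'.+1 then
    if enorm (x - q N') < enorm (x - nearest q N' x) then q N' else nearest q N' x
  else 0.

Lemma nearest_mem q N x : nearest q N x \in 0 :: mkseq q N.
Proof.
elim: N => [|N IH]; first by rewrite /= mem_head.
rewrite -[X in mkseq q X]addn1 /mkseq iotaD map_cat -/(mkseq q N) -cat_cons.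
rewrite mem_cat add0n /=.
by case: ifP => _; rewrite ?IH// mem_seq1 eqxx orbT.
Qed.

Lemma nearest_succ_le q N x :
  enorm (x - nearest q N.+1 x) <= enorm (x - nearest q N x) /\
  enorm (x - nearest q N.+1 x) <= enorm (x - q N).
Proof. by rewrite /=; case: ltP => [/ltW|]. Qed.

Lemma nearest_nonincreasing q k N x : (k <= N)%N ->
  enorm (x - nearest q N x) <= enorm (x - nearest q k x).
Proof.
elim: N => [|N IH]; first by rewrite leqn0 => /eqP ->.
rewrite leq_eqVlt => /predU1P[->//|/IH]; apply: le_trans.
by case: (nearest_succ_le q N x).
Qed.

Lemma nearest_le_enorm q N x : enorm (x - nearest q N x) <= enorm x.
Proof. by rewrite (le_trans (nearest_nonincreasing q x (leq0n N)))//= subr0. Qed.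

Lemma nearest_le q k N x : (k < N)%N ->
  enorm (x - nearest q N x) <= enorm (x - q k).
Proof.
move=> kN; rewrite (le_trans (nearest_nonincreasing q x kN))//.
by case: (nearest_succ_le q k x).
Qed.

Lemma enorm_subr_measurable (a : 'rV[R]_m) :
  measurable_fun setT ((fun x => enorm (x - a)) : borelRV R m -> R).
Proof.
by apply: continuous_borel_measurable; exact: enorm_subr_continuous.
Qed.

Lemma nearest_measurable q N :
  measurable_fun setT (nearest q N : borelRV R m -> borelRV R m) /\
  measurable_fun setT ((fun x => enorm (x - nearest q N x)) : borelRV R m -> R).
Proof.
elim: N => [|N [IH1 IH2]] /=.
  by split; [exact: measurable_cst|exact: enorm_subr_measurable].
have mlt := measurable_fun_ltr (enorm_subr_measurable (q N)) IH2.
split; first by apply: measurable_fun_ifT.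
rewrite (_ : (fun x => _) = (fun x =>
  if enorm (x - q N) < enorm (x - nearest q N x) then enorm (x - q N)
  else enorm (x - nearest q N x))); last by apply/funext => x; case: ifP.
by apply: measurable_fun_ifT => //; exact: enorm_subr_measurable.
Qed.

Lemma dense_sequence_exists :
  exists q, forall x (e : R), 0 < e -> exists n, enorm (x - q n) < e.
Proof.
(* [pickle] enumerates the rational row vectors; indices that code no vector are sent to [0]. *)
pose q n : 'rV[R]_m :=
  if unpickle n is Some v then map_mx ratr (v : 'rV[rat]_m) else 0.
exists q => x e e0; pose e' := e / (m%:R + 1).
have m0 : 0 < m%:R + 1 :> R by rewrite ltr_wpDl.
have e'0 : 0 < e' by rewrite divr_gt0.
have rx i : {z : rat | ratr z \in `]x ord0 i - e', x ord0 i[}.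
  by apply/cid/rat_in_itvoo; rewrite gtrBl.
pose v : 'rV[rat]_m := \row_i sval (rx i).
exists (pickle v); rewrite /q pickleK.
rewrite (@le_lt_trans _ _ (m%:R * e'))//.
  apply: enorm_le_coord => [|i]; first exact: ltW.
  rewrite !mxE; case: (rx i) => z /=; rewrite in_itv /= => /andP[z1 z2].
  by rewrite ger0_norm ?subr_ge0 ?(ltW z2)// lerBlDl -lerBlDr ltW.
by rewrite /e' mulrCA gtr_pMr// ltr_pdivrMr// mul1r ltrDl.
Qed.

Local Open Scope ereal_scope.

(** Dominated convergence: along a dense sequence the displacement of [nearest q N] tends to 0
    pointwise, and the finite first moment makes the majorant [enorm] integrable. *)
Lemma quantizer_exists (theta : probability (borelRV R m) R) (e : R) :
  Omega theta -> (0 < e)%R ->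
  exists (T : {mfun borelRV R m >-> borelRV R m}) (s : seq 'rV[R]_m),
    [/\ forall x, T x \in s,
      measurable_fun setT ((fun x => enorm (x - T x)) : borelRV R m -> R) &
      \int[theta]_x (enorm ((x : 'rV[R]_m) - T x))%:E < e%:E].
Proof.
move=> Otheta e0; have [q qdense] := dense_sequence_exists.
have [| | | | |_ _] := @dominated_convergence _ _ _ theta setT measurableT
  (fun N x => (enorm (x - nearest q N x))%:E) (cst 0) (fun x => (enorm x)%:E).
- by move=> N; apply/measurable_EFinP; case: (nearest_measurable q N).
- exact: measurable_cst.
- apply/aeW => x _; apply: cvg_EFin; first by near=> n.
  apply/cvgrPdist_lt => d d0; have [k kd] := qdense x d d0.
  exists k.+1 => // n /= kn; rewrite sub0r normrN ger0_norm ?enorm_ge0//.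
  by rewrite (le_lt_trans (nearest_le q x kn)).
- apply/integrableP; split.
    apply/measurable_EFinP.
    exact: (continuous_borel_measurable (@enorm_continuous R m)).
  by under eq_integral do rewrite /= ger0_norm ?enorm_ge0//.
- apply/aeW => x N _ /=; rewrite lee_fin ger0_norm ?enorm_ge0//.
  exact: nearest_le_enorm.
rewrite integral_cst// mul0e => /fine_cvgP[fin cv].
move/cvgrPdist_lt : cv => /(_ e e0) cv.
have [N _ /(_ N (leqnn N))[fN cN]] := filterI fin cv.
have [mT mD] := nearest_measurable q N.
exists (mfun_Sub (mem_set mT)), (0%R :: mkseq q N); split => //.
- by move=> x; exact: nearest_mem.
- rewrite [X in X < _](esym (fineK fN)) lte_fin (le_lt_trans _ cN)//.
  by rewrite sub0r normrN ler_norm.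
Unshelve. all: by end_near. Qed.
End NearestPoint.

(** * Integrals of 1-Lipschitz functions and bounds for [d_L] *)

Section LipschitzIntegrals.
Context {R : realType} {m : nat}.
Implicit Types (P Q theta : probability (borelRV R m) R) (h : 'rV[R]_m -> R).

Lemma Lip1_measurable h : Lip1 h -> measurable_fun setT (h : borelRV R m -> R).
Proof. by move=> hL; apply: continuous_borel_measurable; exact: Lip1_continuous. Qed.

Lemma enorm_measurable : measurable_fun setT (@enorm R m : borelRV R m -> R).
Proof. by apply: continuous_borel_measurable; exact: enorm_continuous. Qed.

Lemma enorm_integrable P : Omega P ->
  P.-integrable setT (EFin \o (@enorm R m : borelRV R m -> R)).
Proof.
move=> PO; apply/integrableP; split.
  by apply/measurable_EFinP; exact: enorm_measurable.
by under eq_integral do rewrite /= ger0_norm ?enorm_ge0//.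
Qed.

Lemma Lip1_sub_integrable P h : Omega P -> Lip1 h ->
  P.-integrable setT (EFin \o ((fun x => h x - h 0) : borelRV R m -> R)).
Proof.
move=> PO hL; apply: (le_integrable _ _ _ (enorm_integrable PO)) => //.
  apply/measurable_EFinP/measurable_funB; last exact: measurable_cst.
  exact: Lip1_measurable.
move=> x _; rewrite /= lee_fin (le_trans (hL x 0))// subr0.
by rewrite ger0_norm ?enorm_ge0.
Qed.

Lemma cst_integrable P (c : R) :
  P.-integrable setT (EFin \o (cst c : borelRV R m -> R)).
Proof. exact: finite_measure_integrable_cst. Qed.

Lemma Lip1_integrable P h : Omega P -> Lip1 h ->
  P.-integrable setT (EFin \o (h : borelRV R m -> R)).
Proof.
move=> PO hL.
have := integrableD measurableT (Lip1_sub_integrable PO hL) (cst_integrable P (h 0)).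
by apply: eq_integrable => // x _; rewrite /= -EFinD subrK.
Qed.

(** Centering at [h 0] gives a bound independent of [h], as the supremum in [d_L] requires; the
    constant cancels between two probability measures. *)
Lemma Rintegral_Lip1_near0 P h : Omega P -> Lip1 h ->
  `|\int[P]_x h x - h 0| <= \int[P]_x enorm (x : 'rV[R]_m).
Proof.
move=> PO hL.
have -> : \int[P]_x h x - h 0 = \int[P]_x (h x - h 0).
  rewrite RintegralB//; [|exact: Lip1_integrable|exact: cst_integrable].
  have P1 : fine (P setT) = 1 by rewrite probability_setT.
  by rewrite [X in _ = _ - X]Rintegral_cst// [X in _ * X]P1 mulr1.
rewrite (le_trans (le_normr_Rintegral _ (Lip1_sub_integrable PO hL)))//.
apply: le_Rintegral => //.
- have := integrable_abse (Lip1_sub_integrable PO hL).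
  by apply: eq_integrable.
- exact: enorm_integrable.
- by move=> x _; rewrite (le_trans (hL x 0))// subr0.
Qed.

Lemma d_L_le P Q (c : R) : Omega P -> Omega Q ->
  (forall h, Lip1 h -> `|\int[P]_x h x - \int[Q]_x h x| <= c) ->
  (d_L P Q <= c%:E)%E.
Proof.
move=> PO QO hc; apply: ge_ereal_sup => _ [h hL <-].
rewrite -(fineK (integrable_fin_num measurableT (Lip1_integrable PO hL))).
rewrite -(fineK (integrable_fin_num measurableT (Lip1_integrable QO hL))).
by rewrite -EFinB lee_fin; exact: hc.
Qed.

Lemma bounded_Omega P (c : R) :
  (\int[P]_x (enorm (x : 'rV[R]_m))%:E <= c%:E)%E -> Omega P.
Proof. by move=> /le_lt_trans; apply; exact: ltry. Qed.

(** The pairs [(T x, x)] couple the image measure with [theta], and the cost of this coupling bounds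
    every Lipschitz test. *)
Lemma distribution_Lip1 theta (T : {mfun borelRV R m >-> borelRV R m}) h :
  Omega theta -> Lip1 h ->
  measurable_fun setT ((fun x => enorm (x - T x)) : borelRV R m -> R) ->
  (\int[theta]_x (enorm ((x : 'rV[R]_m) - T x))%:E < +oo)%E ->
  `|\int[distribution theta T]_x h x - \int[theta]_x h x|
    <= \int[theta]_x enorm ((x : 'rV[R]_m) - T x).
Proof.
move=> thetaO hL mT Tfin.
have ih := Lip1_integrable thetaO hL.
have mhT : measurable_fun setT ((fun x => h (T x)) : borelRV R m -> R).
  by apply: (measurableT_comp (Lip1_measurable hL)); exact: measurable_funP.
have iT : theta.-integrable setT
    (EFin \o ((fun x => enorm (x - T x)) : borelRV R m -> R)).
  apply/integrableP; split; first exact/measurable_EFinP.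
  by under eq_integral do rewrite /= ger0_norm ?enorm_ge0//.
have hTle x : `|h (T x) - h x| <= enorm ((x : 'rV[R]_m) - T x).
  by rewrite distrC; exact: hL.
have ihB : theta.-integrable setT
    (EFin \o ((fun x => h (T x) - h x) : borelRV R m -> R)).
  apply: (le_integrable _ _ _ iT) => //.
    by apply/measurable_EFinP/measurable_funB => //; exact: Lip1_measurable.
  by move=> x _; rewrite /= lee_fin [leRHS]ger0_norm ?enorm_ge0.
have ihT : theta.-integrable setT
    (EFin \o ((fun x => h (T x)) : borelRV R m -> R)).
  have := integrableD measurableT ihB ih.
  by apply: eq_integrable => // x _; rewrite /= -EFinD subrK.
have -> : \int[distribution theta T]_x h x = \int[theta]_x h (T x).
  rewrite /Rintegral (@integral_distribution _ _ _ _ _ _ T (EFin \o h))//.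
  by apply/measurable_EFinP; exact: Lip1_measurable.
rewrite -RintegralB// (le_trans (le_normr_Rintegral _ ihB))//.
apply: le_Rintegral => //.
by have := integrable_abse ihB; apply: eq_integrable.
Qed.

(** The mixture formula is available for nonnegative functions only, so it is applied to the
    positive and negative parts of [h], whose integrals are finite. *)
Lemma mixture_Lip1 P Q theta (e : R) h : 0 <= e <= 1 ->
  Omega P -> Omega Q -> Lip1 h ->
  (forall f : borelRV R m -> \bar R, measurable_fun setT f ->
    (forall x, 0 <= f x)%E ->
    \int[theta]_x f x = (1 - e)%:E * \int[P]_x f x + e%:E * \int[Q]_x f x)%E ->
  \int[theta]_x h x = (1 - e) * \int[P]_x h x + e * \int[Q]_x h x.
Proof.
move=> /andP[e0 e1] PO QO hL thetaE.
pose g : borelRV R m -> \bar R := fun x => (h x)%:E.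
have mg : measurable_fun setT g.
  by apply/measurable_EFinP; exact: Lip1_measurable.
have hP : P.-integrable setT g by exact: Lip1_integrable.
have hQ : Q.-integrable setT g by exact: Lip1_integrable.
rewrite /Rintegral -/g.
rewrite [X in fine X]integralE [X in _ = _ * fine X + _]integralE.
rewrite [X in _ = _ + _ * fine X]integralE.
rewrite (thetaE g^\+%E)//; last exact: measurable_funepos.
rewrite (thetaE g^\-%E)//; last exact: measurable_funeneg.
rewrite -(fineK (integrable_pos_fin_num measurableT hP)).
rewrite -(fineK (integrable_neg_fin_num measurableT hP)).
rewrite -(fineK (integrable_pos_fin_num measurableT hQ)).
rewrite -(fineK (integrable_neg_fin_num measurableT hQ)).
rewrite -!EFinM -!EFinD /=.
ring.
Qed.
End LipschitzIntegrals.

(** * Grids of mesh [s ^+ j]: covering, separation, counting *)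

Section Grid.
Context {R : realType} {m : nat}.
Variable s : R.
Hypotheses (s0 : 0 < s) (s2 : s <= 2^-1).
Implicit Types (j : nat) (A : set 'rV[R]_m).

Definition grid_point j (k : {ffun 'I_m -> 'I_(2 ^ j)}) : 'rV[R]_m :=
  \row_i (s ^+ j * (k i)%:R).

Definition grid j : seq 'rV[R]_m := codom (@grid_point j).

Lemma card_grid_index j : #|{ffun 'I_m -> 'I_(2 ^ j)}| = ((2 ^ m) ^ j)%N.
Proof. by rewrite card_ffun !card_ord -!expnM mulnC. Qed.

Lemma size_grid j : size (grid j) = ((2 ^ m) ^ j)%N.
Proof. by rewrite size_codom card_grid_index. Qed.

Lemma big_grid (T : nmodType) (F : 'rV[R]_m -> T) j :
  \sum_(x <- grid j) F x = \sum_k F (@grid_point j k).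
Proof. by rewrite big_map big_enum. Qed.

Lemma grid_neq_nil j : grid j != [::].
Proof. by rewrite -size_eq0 size_grid -lt0n !expn_gt0. Qed.

(* The grid of level [j] lies in a cube of side [(2 s)^j <= (2 s)^J], and the
   grid of level [J] subdivides the cube of side [(2 s)^J] with mesh [s^J]. *)
Lemma grid_cover J j x : (J <= j)%N -> x \in grid j ->
  exists2 y, y \in grid J & enorm (x - y) <= m%:R * s ^+ J.
Proof.
move=> Jj /codomP[k ->].
(* The indices of [y] are those of [x], rescaled to level [J] and rounded down; they stay below
   [2 ^ J] because [(2 s)^(j - J) <= 1]. *)
have lk i : (Num.truncn (s ^+ (j - J) * (k i)%:R) < 2 ^ J)%N.
  rewrite truncn_lt_nat ?mulr_ge0 ?exprn_ge0 ?(ltW s0)//.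
  rewrite (@lt_le_trans _ _ (s ^+ (j - J) * (2 ^ j)%:R))//.
    by rewrite ltr_pM2l ?exprn_gt0// ltr_nat.
  rewrite -[X in (2 ^ X)%N](subnK Jj) expnD natrM mulrA ler_piMl//.
  rewrite natrX -exprMn exprn_ile1// ?mulr_ge0 ?(ltW s0)//.
  by rewrite -ler_pdivlMr// mul1r.
exists (grid_point [ffun i => Ordinal (lk i)]); first exact: codom_f.
apply: enorm_le_coord => [|i]; first by rewrite exprn_ge0 ?ltW.
rewrite !mxE ffunE /= -[in s ^+ j](subnKC Jj) exprD -mulrA -mulrBr.
rewrite normrM ger0_norm ?exprn_ge0 ?(ltW s0)//.
rewrite -[leRHS]mulr1 ler_pM2l ?exprn_gt0//.
have /truncn_itv/andP[t1 t2] : 0 <= s ^+ (j - J) * (k i)%:R.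
  by rewrite mulr_ge0 ?exprn_ge0 ?(ltW s0).
by rewrite ger0_norm ?subr_ge0// lerBlDl natr1 ltW.
Qed.

Lemma grid_separated j k k' : k != k' ->
  exists i, s ^+ j <= `|(grid_point k - @grid_point j k') ord0 i|.
Proof.
move=> kk'; have [i kk'i] : exists i, k i != k' i.
  by apply/existsP; apply: contra_neqT kk'; rewrite negb_exists => /forallP kk';
     apply/ffunP => i; apply/eqP; move: (kk' i); rewrite negbK.
exists i; rewrite !mxE -mulrBr normrM ger0_norm ?exprn_ge0 ?(ltW s0)//.
rewrite ler_peMr ?exprn_ge0 ?(ltW s0)//.
have : (k i != k' i :> nat) by [].
rewrite neq_ltn => /orP[] lt; [rewrite distrC|];
  by rewrite (le_trans _ (ler_norm _))// lerBrDr nat1r ler_nat.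
Qed.

(* Points of the grid are [s^j] apart, so each point of [A] is within [s^j / 2]
   of at most one of them. *)
Lemma few_near_points A n j : A !=set0 -> A #<= `I_n ->
  (#|[set k | (dist_set A (@grid_point j k) < s ^+ j / 2)%R]%SET| <= n)%N.
Proof.
move=> A0 /pcard_leP[F]; set B := [set k | _]%SET.
have [f [fA f_inj]] : exists f : 'rV[R]_m -> nat,
    (forall a, A a -> (f a < n)%N) /\ {in A &, injective f}.
  by exists F; split; [exact: (@funS _ _ _ _ F)|exact: inj].
have near k : k \in B -> exists a, A a /\ enorm (@grid_point j k - a) < s ^+ j / 2.
  by rewrite inE => /(dist_set_lt A0)[a]; exists a.
have /choice[g gP] k : exists a,
    k \in B -> A a /\ enorm (@grid_point j k - a) < s ^+ j / 2.
  by have [/near[a ?]|] := boolP (k \in B); [exists a|exists 0].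
have fg k : k \in B -> (f (g k) < n)%N.
  by move=> /gP[Ag _]; exact: fA.
(* The case [n = 0] is settled first, since [inord] needs a nonempty ordinal type. *)
have [n0|n0] := posnP n.
  by rewrite n0 leqn0 cards_eq0; apply/eqP/setP => k; rewrite finset.in_set0;
     apply/negP => /fg; rewrite n0.
case: n n0 {F fA} fg => // n _ fg.
rewrite -[leqRHS]card_ord -(card_in_imset (f := fun k => inord (f (g k)) : 'I_n.+1)).
  exact: max_card.
move=> k k' kB k'B /(congr1 val); rewrite /= !inordK ?fg// => fE.
have gE : g k = g k'.
  by apply: f_inj => //; rewrite inE; [have [] := gP _ kB|have [] := gP _ k'B].
apply/eqP; apply: contraT => /grid_separated[i].
have [_ /(le_lt_trans (coord_le_enorm _ i)) h] := gP _ kB.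
have [_ /(le_lt_trans (coord_le_enorm _ i)) h'] := gP _ k'B.
rewrite leNgt => /negP[]; move: h h'; rewrite -gE !mxE => h h'.
by rewrite [ltRHS]splitr (le_lt_trans (ler_distD (g k ord0 i) _ _))//
   ltrD// distrC.
Qed.

(** By [few_near_points], at most [n], hence at most half, of the grid points are near [A]; each of
    the others is at distance at least [s ^+ j / 2]. *)
Lemma grid_dist_sum A n j (r : R) : 0 <= r -> A !=set0 -> A #<= `I_n ->
  (2 * n <= (2 ^ m) ^ j)%N ->
  ((2 ^ m) ^ j)%:R / 2 * (s ^+ j / 2) `^ r <=
  \sum_(x <- grid j) dist_set A x `^ r.
Proof.
move=> r0 A0 An nj; rewrite big_grid; have := few_near_points j A0 An.
set B := [set k | _]%SET => Bn.
rewrite (@le_trans _ _ (\sum_(k in ~: B) (s ^+ j / 2) `^ r))//; last first.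
  rewrite [leRHS](bigID (mem B))/= ler_wpDl ?sumr_ge0// => [k _|].
    exact: powR_ge0.
  rewrite (eq_bigl (fun k => k \notin B)); last by move=> k; rewrite inE.
  apply: ler_sum => k; rewrite inE -leNgt => kB.
  by rewrite ge0_ler_powR// nnegrE ?dist_set_ge0// divr_ge0// exprn_ge0 ?ltW.
rewrite sumr_const -[leRHS]mulr_natl ler_wpM2r ?powR_ge0//.
rewrite ler_pdivrMr// -natrM ler_nat.
have := cardsC B; rewrite card_grid_index; clear s2; lia.
Qed.
End Grid.

(** * The probability measure carried by all the grids *)

Lemma telescoping_weights (R : realType) :
  (\sum_(j <oo) ((j.+1%:R * j.+2%:R)^-1 : R)%:E = 1)%E.
Proof.
apply: cvg_lim => //.
(* Each weight is [1/(j+1) - 1/(j+2)], so the partial sums telescope. *)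
have -> : (fun n => \sum_(0 <= j < n) ((j.+1%:R * j.+2%:R)^-1 : R)%:E)%E =
    (fun n => ((1 - n.+1%:R^-1 : R)%:E)).
  apply/funext; elim => [|n IH].
    by rewrite big_nil invr1 subrr.
  rewrite big_nat_recr//= IH -EFinD; congr EFin.
  have : n.+1%:R + 1 != 0 :> R by rewrite natr1 pnatr_eq0.
  have : n.+1%:R != 0 :> R by rewrite pnatr_eq0.
  rewrite -[n.+2%:R]natr1; move: (n.+1%:R : R) => a a0 a1; field.
  by rewrite a0 a1.
apply: cvg_EFin; first by near=> n.
rewrite -[X in _ --> X]subr0; apply: cvgB; first exact: cvg_cst.
exact: cvg_harmonic.
Unshelve. all: by end_near. Qed.

Section GridMeasure.
Local Open Scope ereal_scope.
Context {R : realType} {m : nat}.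
Variable s : R.

(** Two consequences of the series formula are kept: total mass 1 turns a bound on all grids into a
    bound on the integral, and a single level bounds the integral from below. *)
Lemma grid_measure_exists :
  exists mu : probability (borelRV R m) R,
    forall f : borelRV R m -> \bar R,
    measurable_fun setT f -> (forall x, 0 <= f x) ->
    (forall c : R, (forall j (x : 'rV[R]_m), x \in grid s j -> f x <= c%:E) ->
      \int[mu]_x f x <= c%:E) /\
    (forall j, ((j.+1%:R * j.+2%:R)^-1 / ((2 ^ m) ^ j)%:R)%:E *
      \sum_(x <- grid s j) f (x : 'rV[R]_m) <= \int[mu]_x f x).
Proof.
have /choice[U UE] j := @uniform_exists _ (borelRV R m) R _ (grid_neq_nil s j).
have w0 j : (0 <= (j.+1%:R * j.+2%:R)^-1 :> R)%R.
  by rewrite invr_ge0 mulr_ge0.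
have [mu muE] := mixture_exists U w0 (telescoping_weights R).
exists mu => f mf f0; rewrite muE//.
have term0 j : 0 <= ((j.+1%:R * j.+2%:R)^-1)%:E * \int[U j]_x f x.
  by rewrite mule_ge0 ?lee_fin// integral_ge0.
split=> [c fc|j].
  have c0 : (0 <= c)%R.
    have := @grid_neq_nil R m s 0; case E : grid => [//|x l] _.
    by rewrite -lee_fin (le_trans (f0 x))// (fc 0%N)// E mem_head.
  rewrite -[leRHS]mule1 -[X in _ * X](telescoping_weights R) -nneseriesZl//.
  apply: lee_nneseries => // j _; rewrite [leRHS]muleC.
  apply: lee_wpmul2l; first by rewrite lee_fin.
  rewrite UE// size_grid big_grid.
  apply: (@le_trans _ _ ((((2 ^ m) ^ j)%:R^-1)%:E *
      \sum_(k : {ffun 'I_m -> 'I_(2 ^ j)}) c%:E)).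
    apply: lee_wpmul2l; first by rewrite lee_fin.
    by apply: lee_sum => k _; apply: (fc j); exact: codom_f.
  rewrite sumEFin sumr_const card_grid_index -EFinM.
  rewrite lee_fin -[X in (_ * X)%R]mulr_natl mulKf//.
rewrite (@le_trans _ _ (((j.+1%:R * j.+2%:R)^-1)%:E * \int[U j]_x f x))//.
  by rewrite UE// size_grid muleA.
rewrite [leRHS](nneseries_split 0 j.+1)// add0n.
apply: le_trans (leeDl _ (nneseries_ge0 (fun n _ _ => term0 n))).
rewrite big_nat_recr//=; apply: leeDr; exact: sume_ge0.
Qed.
End GridMeasure.

(** * Quantization errors of a mixture of [P] and the grid measure *)

Section MixtureQuantization.
Context {R : realType} {m : nat}.
Variables (P mu Q : probability (borelRV R m) R) (e s r : R).
Hypotheses (e_gt0 : 0 < e) (e_le1 : e <= 1) (s_gt0 : 0 < s) (s_le : s <= 2^-1).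
Hypothesis r_gt0 : 0 < r.
Hypothesis QE : forall f : borelRV R m -> \bar R, measurable_fun setT f ->
  (forall x, 0 <= f x)%E ->
  (\int[Q]_x f x = (1 - e)%:E * \int[P]_x f x + e%:E * \int[mu]_x f x)%E.

Lemma card_le_set_seq (T : choiceType) (x0 : T) (l : seq T) :
  [set` l] #<= `I_(size l).
Proof.
rewrite (_ : [set` l] = nth x0 l @` `I_(size l)); first exact: card_image_le.
apply/seteqP; split => x /=; last by move=> [i il <-]; exact: mem_nth.
by move=> xl; exists (index x l); rewrite ?index_mem// nth_index.
Qed.

Lemma quant_error_le_seq (theta : probability (borelRV R m) R)
    (l : seq 'rV[R]_m) (n : nat) : l != [::] -> (size l <= n)%N ->
  (quant_error n r theta <=
    \int[theta]_x (dist_set [set` l] (x : borelRV R m) `^ r)%:E)%E.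
Proof.
move=> l0 ln; apply: ereal_inf_lbound; exists [set` l] => //; split.
  by case: l l0 {ln} => // a l _; exists a; rewrite /= mem_head.
by rewrite (card_le_trans (card_le_set_seq 0 l))// card_le_II.
Qed.

(** The quantizer joins [s0], which makes the contribution of [P] vanish, to all grids of level at
    most [J], the last of which controls the finer ones by [grid_cover]. The factor [e] is bounded
    by 1. *)
Lemma mixture_quant_error_le (s0 : seq 'rV[R]_m) (J n : nat) : s0 != [::] ->
  (forall f : borelRV R m -> \bar R, measurable_fun setT f ->
    (forall x, 0 <= f x)%E -> (forall x : 'rV[R]_m, x \in s0 -> f x = 0%E) ->
    (\int[P]_x f x = 0)%E) ->
  (forall f : borelRV R m -> \bar R, measurable_fun setT f ->
    (forall x, 0 <= f x)%E ->
    forall c : R, (forall j (x : 'rV[R]_m), x \in grid s j -> f x <= c%:E)%E ->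
      (\int[mu]_x f x <= c%:E)%E) ->
  (size s0 + \sum_(j < J.+1) (2 ^ m) ^ j <= n)%N ->
  (quant_error n r Q <= ((m%:R * s ^+ J) `^ r)%:E)%E.
Proof.
move=> s0nil P0 mu_le sn.
pose l := s0 ++ flatten [seq grid s j | j <- iota 0 J.+1].
have gridl j : (j <= J)%N -> {subset grid s j <= l}.
  move=> jJ x xj; rewrite mem_cat; apply/orP; right; apply/flattenP.
  by exists (grid s j) => //; apply/mapP; exists j => //; rewrite mem_iota.
have size_l : size l = (size s0 + \sum_(j < J.+1) (2 ^ m) ^ j)%N.
  rewrite size_cat size_flatten sumnE /shape -map_comp big_map.
  congr addn; rewrite -[iota _ _]/(index_iota 0 J.+1) big_mkord.
  by apply: eq_bigr => j _ /=; rewrite size_grid.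
have l0 : [set` l] !=set0.
  case: s0 s0nil @l {P0 sn gridl size_l} => // a s1 _ l.
  by exists a; rewrite /= mem_head.
have [mf f0] : measurable_fun setT
    ((fun x => (dist_set [set` l] x `^ r)%:E) : borelRV R m -> \bar R) /\
    (forall x : borelRV R m, 0 <= (dist_set [set` l] x `^ r)%:E)%E.
  by split => [|x]; [exact: dist_powR_measurable|rewrite lee_fin powR_ge0].
apply: le_trans (quant_error_le_seq Q (_ : l != [::]) (_ : size l <= n)%N) _.
- by case: l l0 {gridl size_l mf f0} => // -[].
- by rewrite size_l.
rewrite QE// P0// => [|x xs]; last first.
  by rewrite dist_set_mem ?powR0 ?gt_eqF//= mem_cat xs.
rewrite mule0 add0e -[leRHS]mul1e.
apply: lee_pmul => //; [by rewrite lee_fin ltW|exact: integral_ge0|].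
apply: mu_le => // j x xj; rewrite lee_fin ge0_ler_powR ?(ltW r_gt0)//.
- by rewrite nnegrE dist_set_ge0.
- by rewrite nnegrE mulr_ge0// exprn_ge0// ltW.
have [jJ|/ltnW Jj] := leqP j J.
  rewrite dist_set_mem ?mulr_ge0 ?exprn_ge0 ?(ltW s_gt0)//.
  exact: (gridl j).
have [y yJ] := grid_cover s_gt0 s_le Jj xj.
by apply: le_trans; apply: dist_set_le; exact: (gridl J).
Qed.

(** [P] and all levels but [j] are discarded. The number of grid points in [grid_dist_sum] cancels
    the normalisation of the uniform measure, which leaves half of the weight. *)
Lemma mixture_quant_error_ge (j n : nat) :
  (forall f : borelRV R m -> \bar R, measurable_fun setT f ->
    (forall x, 0 <= f x)%E ->
    (((j.+1%:R * j.+2%:R)^-1 / ((2 ^ m) ^ j)%:R)%:E *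
      \sum_(x <- grid s j) f (x : 'rV[R]_m) <= \int[mu]_x f x)%E) ->
  (2 * n <= (2 ^ m) ^ j)%N ->
  ((e * ((j.+1%:R * j.+2%:R)^-1 / 2 * (s ^+ j / 2) `^ r))%:E
    <= quant_error n r Q)%E.
Proof.
move=> muge nj; apply: le_ereal_inf_tmp => _ [A [A0 An] <-].
have mf := dist_powR_measurable r A0.
have f0 (x : borelRV R m) : (0 <= (dist_set A x `^ r)%:E)%E.
  by rewrite lee_fin powR_ge0.
rewrite QE// EFinM.
apply: (@le_trans _ _
    (e%:E * \int[mu]_x (dist_set A (x : borelRV R m) `^ r)%:E)%E); last first.
  by rewrite leeDr// mule_ge0 ?integral_ge0// lee_fin subr_ge0.
apply: lee_wpmul2l; first by rewrite lee_fin ltW.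
apply: le_trans (muge _ mf f0); rewrite sumEFin lee_fin.
have Mj0 : (0 < ((2 ^ m) ^ j)%:R :> R) by rewrite ltr0n !expn_gt0.
have := grid_dist_sum s_gt0 (ltW r_gt0) A0 An nj.
move=> /(ler_wpM2l (_ : 0 <= (j.+1%:R * j.+2%:R)^-1 / ((2 ^ m) ^ j)%:R))H.
apply: le_trans (H _); last by rewrite divr_ge0// invr_ge0 mulr_ge0.
rewrite le_eqVlt; apply/orP; left; apply/eqP.
rewrite !mulrA; congr (_ * _); rewrite -!mulrA; congr (_ * _).
by rewrite mulKf// gt_eqF.
Qed.
End MixtureQuantization.

(** * From bounds on the errors to the limit of the quotient *)

Section LogAsymptotics.
Context {R : realType}.
Implicit Types (V : nat -> \bar R) (r alpha : R).

Lemma ln_nat_ge (K : R) : \forall n \near \oo, K <= ln n%:R.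
Proof.
near=> n; have Kn : expR K <= n%:R by near: n; exact: nbhs_infty_ger.
by rewrite -[K]expRK ler_ln ?posrE ?expR_gt0// (lt_le_trans (expR_gt0 K)).
Unshelve. all: by end_near. Qed.

(* In logarithmic form: [V n] is [n^(-r/alpha)] up to constants and up to
   arbitrarily small powers of [n] in the lower bound. *)
Lemma quotient_cvg V r alpha : 0 < r -> 0 < alpha ->
  (exists C, \forall n \near \oo,
     (V n <= (expR (C - r / alpha * ln n%:R))%:E)%E) ->
  (forall eta, 0 < eta -> exists C, \forall n \near \oo,
     ((expR (- (C + (r / alpha + eta) * ln n%:R)))%:E <= V n)%E) ->
  ((r * ln n%:R)%:E / - lne (V n))%E @[n --> \oo] --> alpha%:E.
Proof.
move=> r0 a0 [C VC] Vge.
have ra0 : 0 < r / alpha by rewrite divr_gt0.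
pose L n : R := - ln (fine (V n)).
(* The instance [eta = 1] makes [V n] eventually positive; with the upper bound it is a positive
   real, so its logarithm is finite. *)
have [C1 VC1] := Vge 1 ltr01.
have VE : \forall n \near \oo, V n = (expR (- L n))%:E.
  near=> n.
  have : (V n <= (expR (C - r / alpha * ln n%:R))%:E)%E by near: n.
  have : ((expR (- (C1 + (r / alpha + 1) * ln n%:R)))%:E <= V n)%E by near: n.
  rewrite /L; case: (V n) => [v| |]//=; rewrite ?leye_eq// !lee_fin => v0 _.
  by rewrite opprK lnK// posrE (lt_le_trans (expR_gt0 _) v0).
have Lcvg : L n / ln n%:R @[n --> \oo] --> r / alpha.
  (* Half of [e] goes to the exponent; the other half absorbs [C'] once [ln n] is large. *)
  apply/cvgrPdist_le => e e0; have e20 : 0 < e / 2 by rewrite divr_gt0.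
  have [C' VC'] := Vge _ e20.
  near=> n.
  have VnE : V n = (expR (- L n))%:E by near: n.
  have y0 : 1 <= ln n%:R :> R by near: n; exact: ln_nat_ge.
  have yC : C / e <= ln n%:R by near: n; exact: ln_nat_ge.
  have yC' : C' / (e / 2) <= ln n%:R by near: n; exact: ln_nat_ge.
  have : (V n <= (expR (C - r / alpha * ln n%:R))%:E)%E by near: n.
  have : ((expR (- (C' + (r / alpha + e / 2) * ln n%:R)))%:E <= V n)%E by near: n.
  rewrite VnE !lee_fin !ler_expR.
  move: yC yC'; rewrite !ler_pdivrMr// => yC yC' Lle Lge.
  rewrite ler_distlC; apply/andP; split.
    by rewrite ler_pdivlMr ?(lt_le_trans _ y0)// mulrBl; lra.
  by rewrite ler_pdivrMr ?(lt_le_trans _ y0)// mulrDl; lra.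
have qcvg : r * (L n / ln n%:R)^-1 @[n --> \oo] --> alpha.
  have -> : alpha = r * (r / alpha)^-1 by rewrite invf_div mulrCA divff ?mulr1 ?gt_eqF.
  by apply: cvgMr; apply: cvgV => //; rewrite gt_eqF.
have qE : \forall n \near \oo,
    ((r * ln n%:R)%:E / - lne (V n))%E = (r * (L n / ln n%:R)^-1)%:E.
  near=> n.
  have VnE : V n = (expR (- L n))%:E by near: n.
  have y0 : 1 <= ln n%:R :> R by near: n; exact: ln_nat_ge.
  (* This threshold gives [L n >= 1], so the extended quotient is a division of reals. *)
  have yC : (C + 1) / (r / alpha) <= ln n%:R by near: n; exact: ln_nat_ge.
  have : (V n <= (expR (C - r / alpha * ln n%:R))%:E)%E by near: n.
  rewrite VnE lee_fin ler_expR => VL.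
  have L0 : 0 < L n.
    by move: yC; rewrite ler_pdivrMr// => yC; lra.
  rewrite lne_EFin ?expR_gt0// expRK -EFinN opprK inver gt_eqF// -EFinM.
  by rewrite invf_div mulrA.
apply/fine_cvgP; split; first by near=> n; rewrite (near qE n).
apply: cvg_trans qcvg; apply: near_eq_cvg; near=> n.
by rewrite /= (near qE n).
Unshelve. all: by end_near. Qed.

Lemma log_index_bounds (M n : nat) : (1 < M)%N -> (0 < n)%N ->
  (trunc_log M n)%:R * ln (M%:R : R) <= ln (n%:R : R) <=
    (trunc_log M n).+1%:R * ln M%:R.
Proof.
move=> M1 n0; have M0 : 0 < M%:R :> R by rewrite ltr0n ltnW.
have /andP[jn nj] := trunc_log_bounds M1 n0.
rewrite !mulr_natl -!lnXn// -!natrX !ler_ln ?posrE ?ltr0n ?expn_gt0 ?(ltnW M1)//.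
by rewrite !ler_nat jn ltnW.
Qed.

(** Apply [ln y < y] to [y = eta * x]. This later absorbs the logarithms of the polynomial weights
    into a small multiple of [ln n]. *)
Lemma ln_le_linear (eta : R) : 0 < eta ->
  exists C, forall x, 0 < x -> ln x <= eta * x + C.
Proof.
move=> eta0; exists (- ln eta) => x x0.
rewrite -lerBlDr opprK -lnM ?posrE//.
by rewrite (le_trans (ltW (ln_sublinear _)))// ?mulr_gt0// mulrC.
Qed.

Lemma geometric_quotient_cvg V r alpha (e b : R) (M c : nat) :
  (1 < M)%N -> 0 < r -> 0 < alpha -> 0 < e -> 0 < b ->
  (* [s^(-alpha) = M] *)
  let s := expR (- (ln M%:R / alpha)) in
  (forall J n, (M ^ (J + c) <= n)%N -> (V n <= ((b * s ^+ J) `^ r)%:E)%E) ->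
  (forall j n, (2 * n <= M ^ j)%N ->
    ((e * ((j.+1%:R * j.+2%:R)^-1 / 2 * (s ^+ j / 2) `^ r))%:E <= V n)%E) ->
  ((r * ln n%:R)%:E / - lne (V n))%E @[n --> \oo] --> alpha%:E.
Proof.
move=> M1 r0 a0 e0 b0 s Vle Vge; pose l : R := ln M%:R.
have l0 : 0 < l by rewrite ln_gt0// ltr1n.
have s0 : 0 < s by exact: expR_gt0.
have lns : ln s = - (l / alpha) by rewrite expRK.
have k0 : 0 < r / alpha by rewrite divr_gt0.
apply: quotient_cvg => //.
  (* With [M ^ j <= n < M ^ (j+1)], the level [j - c] is used: in [c.+1], the [c] pays for this
     shift and the 1 for rounding down the logarithm. *)
  exists (r * ln b + r / alpha * (c.+1%:R * l)); near=> n.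
  have n0 : (0 < n)%N by near: n; exact: nbhs_infty_gt.
  have cn : (M ^ c <= n)%N by near: n; exact: nbhs_infty_ge.
  set j := trunc_log M n; have cj : (c <= j)%N by exact: trunc_log_max.
  have Jn : (M ^ (j - c + c) <= n)%N by rewrite subnK// trunc_logP.
  apply: le_trans (Vle _ _ Jn) _; rewrite lee_fin.
  rewrite -[leLHS]lnK ?posrE ?powR_gt0 ?mulr_gt0 ?exprn_gt0// ler_expR.
  rewrite ln_powR lnM ?posrE ?exprn_gt0// lnXn// lns -[_ *+ (j - c)]mulr_natl natrB//.
  have /andP[_ nj] := log_index_bounds M1 n0.
  have := ler_wpM2l (ltW k0) nj; rewrite -/j -/l -!natr1.
  have -> x : r * (ln b + x * - (l / alpha)) = r * ln b - r / alpha * (x * l).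
    by field; rewrite gt_eqF.
  lra.
(* The weight contributes [ln (j+3)] and [ln (j+4)]; each receives half of the allowance [eta * l]
   per level. *)
move=> eta eta0; have eta4 : 0 < eta * l / 2 by rewrite divr_gt0 ?mulr_gt0.
have [C0 lnC0] := ln_le_linear eta4.
(* [4 * eta * l] covers the [7/2] coming from the offsets 3 and 4; [2 * l] comes from the two extra
   levels. *)
exists (- ln (e / 2) + 2 * C0 + 4 * eta * l + r * ln 2 + r / alpha * (2 * l)).
near=> n.
have n0 : (0 < n)%N by near: n; exact: nbhs_infty_gt.
set j := trunc_log M n.
(* One extra level exceeds [n], the second supplies the factor 2 because [M >= 2]. *)
have nj : (2 * n <= M ^ j.+2)%N.
  by rewrite expnS leq_mul// ltnW// trunc_log_ltn.
apply: le_trans (Vge _ _ nj); rewrite lee_fin.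
rewrite -[leRHS]lnK ?posrE; last first.
  by rewrite !mulr_gt0 ?invr_gt0 ?mulr_gt0 ?powR_gt0 ?divr_gt0 ?exprn_gt0.
rewrite ler_expR.
have -> : e * ((j.+3%:R * j.+4%:R)^-1 / 2 * (s ^+ j.+2 / 2) `^ r) =
   e / 2 * (j.+3%:R^-1 * j.+4%:R^-1 * (s ^+ j.+2 / 2) `^ r).
  by rewrite invfM; ring.
rewrite !lnM ?posrE ?mulr_gt0 ?invr_gt0 ?powR_gt0 ?divr_gt0 ?exprn_gt0//.
rewrite !lnV ?posrE// ln_powR ln_div ?posrE ?exprn_gt0// lnXn// lns.
have /andP[jn _] := log_index_bounds M1 n0.
rewrite -/j -/l in jn; rewrite -[_ *+ j.+2]mulr_natl.
have -> : r * (j.+2%:R * - (l / alpha) - ln 2) =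
    - (r / alpha * (j.+2%:R * l)) - r * ln 2 by field; rewrite gt_eqF.
have := ler_wpM2l (ltW k0) jn; have := ler_wpM2l (ltW eta0) jn.
have := lnC0 j.+3%:R (ltr0Sn _ _); have := lnC0 j.+4%:R (ltr0Sn _ _).
have := mulr_gt0 eta0 l0.
rewrite -[j.+4%:R]natr1 -[j.+3%:R]natr1 -[j.+2%:R]natr1 -[j.+1%:R]natr1.
lra.
Unshelve. all: by end_near. Qed.
End LogAsymptotics.

(** * The approximating measures and the density theorem *)

Section Density.
Context {R : realType} {m : nat}.
Implicit Types theta : probability (borelRV R m) R.

Lemma finite_support_quant_dim0 theta (l : seq 'rV[R]_m) (r : R) :
  0 < r -> l != [::] ->
  (forall f : borelRV R m -> \bar R, measurable_fun setT f ->
    (forall x, 0 <= f x)%E -> (forall x : 'rV[R]_m, x \in l -> f x = 0%E) ->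
    (\int[theta]_x f x = 0)%E) ->
  has_quant_dim r theta 0.
Proof.
move=> r0 lnil theta0.
have V0 n : (size l <= n)%N -> quant_error n r theta = 0%E.
  move=> ln; apply/le_anti/andP; split.
    apply: le_trans (quant_error_le_seq r theta lnil ln) _.
    rewrite theta0//.
    - apply: dist_powR_measurable.
      by case: l lnil {theta0 ln} => // a l _; exists a; rewrite /= mem_head.
    - by move=> x; rewrite lee_fin powR_ge0.
    - by move=> x xl; rewrite dist_set_mem// powR0// gt_eqF.
  apply: le_ereal_inf_tmp => _ [A _ <-]; apply: integral_ge0 => x _.
  by rewrite lee_fin powR_ge0.
apply: cvg_near_cst; near=> n.
have ln : (size l <= n)%N by near: n; exact: nbhs_infty_ge.
(* A zero error makes the denominator [+oo], whose inverse is 0. *)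
by rewrite /quant_quotient V0// le0_lneNy//= invey mule0.
Unshelve. all: by end_near. Qed.

Lemma distribution_integral0 theta (T : {mfun borelRV R m >-> borelRV R m})
    (l : seq 'rV[R]_m) : (forall x, T x \in l) ->
  forall f : borelRV R m -> \bar R, measurable_fun setT f ->
    (forall x, 0 <= f x)%E -> (forall x : 'rV[R]_m, x \in l -> f x = 0%E) ->
    (\int[distribution theta T]_x f x = 0)%E.
Proof.
move=> Tl f mf f0 fl.
rewrite (@ge0_integral_distribution _ _ _ _ _ theta T)//.
by rewrite integral0_eq// => x _ /=; exact: fl.
Qed.

Lemma distribution_Omega theta (T : {mfun borelRV R m >-> borelRV R m})
    (l : seq 'rV[R]_m) : (forall x, T x \in l) ->
  Omega (distribution theta T).
Proof.
move=> Tl; apply: (@bounded_Omega _ _ _ (\sum_(y <- l) enorm y)).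
rewrite (@ge0_integral_distribution _ _ _ _ _ theta T (EFin \o @enorm R m))//.
- apply: (@le_trans _ _ (\int[theta]_x (\sum_(y <- l) enorm y)%:E)%E).
    apply: ge0_le_integral => //.
    + by move=> x _; rewrite lee_fin enorm_ge0.
    + apply: measurableT_comp; last exact: measurable_funP.
      by apply/measurable_EFinP; exact: enorm_measurable.
    + move=> x _; rewrite lee_fin /= (big_rem _ (Tl x))/= lerDl.
      by apply: sumr_ge0 => y _; exact: enorm_ge0.
  by rewrite integral_cst// [X in (_ * X)%E](@probability_setT _ _ _ theta) mule1.
- by apply/measurable_EFinP; exact: enorm_measurable.
- by move=> x; rewrite lee_fin enorm_ge0.
Qed.

(** Level 0 is the origin alone, so [grid_cover] with [J = 0] bounds every grid; this gives the grid
    measure a finite first moment. *)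
Lemma grid_enorm_le (s : R) j (x : 'rV[R]_m) : 0 < s -> s <= 2^-1 ->
  x \in grid s j -> enorm x <= m%:R.
Proof.
move=> s0 s2 /(grid_cover s0 s2 (leq0n j))[y /codomP[k ->]].
have -> : @grid_point R m s 0 k = 0.
  apply/rowP => i; rewrite !mxE expr0 mul1r.
  by case: (k i) => -[|//] /= _.
by rewrite subr0 expr0 mulr1.
Qed.

Lemma sum_powers_lt M J : (1 < M)%N -> (\sum_(j < J) M ^ j < M ^ J)%N.
Proof.
move=> M1; elim: J => [|J IH]; first by rewrite big_ord0.
rewrite big_ord_recr/= expnS (leq_trans (_ : _ < M ^ J + M ^ J)%N)//.
  by rewrite ltn_add2r.
by rewrite addnn -mul2n leq_mul2r M1 orbT.
Qed.

(** Since [k < M ^ k], [k] extra points cost only a shift of the exponent independent of [J]; this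
    provides the constant [c] of [geometric_quotient_cvg]. *)
Lemma add_sum_powers_le k M J : (1 < M)%N ->
  (k + \sum_(j < J.+1) M ^ j <= M ^ (J + k.+1))%N.
Proof.
move=> M1; rewrite addnS -addSn expnD.
rewrite (@leq_trans (M ^ J.+1 * k.+1))//; last by rewrite leq_mul2l ltn_expl// orbT.
rewrite mulnS addnC leq_add ?(ltnW (sum_powers_lt _ M1))//.
by rewrite leq_pmull// expn_gt0 ltnW.
Qed.

End Density.

(** The ratio is [2^(-m/alpha)], and [alpha <= m] makes [m/alpha] at least 1. *)
Lemma grid_ratio (R : realType) (m : nat) (alpha : R) :
  0 < alpha -> alpha <= m%:R -> expR (- (ln (2 ^ m)%:R / alpha)) <= 2^-1 :> R.
Proof.
move=> a0 am; rewrite -[leRHS]lnK ?posrE ?invr_gt0// ler_expR lnV ?posrE//.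
rewrite lerN2 natrX lnXn// -[_ *+ m]mulr_natr -mulrA ler_peMr ?ln_ge0 ?ler1n//.
by rewrite ler_pdivlMr// mul1r.
Qed.

Theorem theorem3p13 (R : realType) (m : nat) (r alpha : R)
  (r_gt0 : 0 < r) (alpha_ge0 : 0 <= alpha) (alpha_lem : alpha <= m%:R) :
  d_L_dense (@S_ R m r alpha).
Proof.
split=> [theta []//|theta thetaO eps eps0].
have eps20 : 0 < eps / 2 by rewrite divr_gt0.
have [T [l [Tl mT Tint]]] := quantizer_exists thetaO eps20.
pose P := distribution theta T.
have PO : Omega P := distribution_Omega theta Tl.
have P0 := distribution_integral0 theta Tl.
have lnil : l != [::] by move: (Tl 0); case: (l).
have Plip h : Lip1 h -> `|\int[P]_x h x - \int[theta]_x h x| <= eps / 2.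
  move=> hL; apply: le_trans (distribution_Lip1 thetaO hL mT _) _.
    by rewrite (lt_trans Tint)// ltry.
  have Tfin : (\int[theta]_x (enorm ((x : 'rV[R]_m) - T x))%:E)%E \is a fin_num.
    rewrite ge0_fin_numE; first by rewrite (lt_trans Tint)// ltry.
    by apply: integral_ge0 => x _; rewrite lee_fin enorm_ge0.
  by rewrite -lee_fin fineK// ltW.
have [alpha_le0|alpha_gt0] := leP alpha 0.
  have -> : alpha = 0 by apply/le_anti; rewrite alpha_le0.
  exists P; first by split=> //; exact: finite_support_quant_dim0 lnil P0.
  apply: (@le_lt_trans _ _ (eps / 2)%:E); first exact: d_L_le.
  by rewrite lte_fin ltr_pdivrMr// ltr_pMr// ltr1n.
(* A positive [alpha] rules out [m = 0], so the base [2 ^ m] exceeds 1. *)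
have m0 : 0 < m%:R :> R by exact: lt_le_trans alpha_lem.
have M1 : (1 < 2 ^ m)%N by rewrite -[1%N](expn0 2) ltn_exp2l// -(ltr_nat R).
set s : R := expR (- (ln (2 ^ m)%:R / alpha)).
have s0 : 0 < s := expR_gt0 _.
have s2 : s <= 2^-1 := grid_ratio alpha_gt0 alpha_lem.
have [mu muP] := @grid_measure_exists R m s.
have muO : Omega mu.
  apply: (@bounded_Omega _ _ _ m%:R).
  apply: (muP (EFin \o @enorm R m) _ _).1 => [|x|j x xj].
  - by apply/measurable_EFinP; exact: enorm_measurable.
  - by rewrite lee_fin enorm_ge0.
  - by rewrite lee_fin (grid_enorm_le s0 s2 xj).
(* [K] bounds, uniformly in [h], the difference between the integrals over [mu] and [P]; [e] is
   chosen with [e <= 1] and [e * K < eps / 2], also when [K = 0]. *)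
pose K := \int[mu]_x enorm (x : 'rV[R]_m) + \int[P]_x enorm (x : 'rV[R]_m).
have K0 : 0 <= K by rewrite addr_ge0// Rintegral_ge0// => x _; exact: enorm_ge0.
pose e := eps / (2 * K + eps + eps).
have D0 : 0 < 2 * K + eps + eps by lra.
have e0 : 0 < e by rewrite divr_gt0.
have e1 : e <= 1 by rewrite ler_pdivrMr// mul1r; lra.
have eK : e * K < eps / 2.
  by rewrite /e mulrAC ltr_pdivrMr//; nra.
have e01 : 0 <= e <= 1 by rewrite (ltW e0).
have [Q QE] := convex_combination_exists P mu e01.
have QO : Omega Q.
  have men : measurable_fun setT ((EFin \o @enorm R m) : borelRV R m -> \bar R).
    by apply/measurable_EFinP; exact: enorm_measurable.
  rewrite /Omega /= (QE (EFin \o @enorm R m))//; last first.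
    by move=> x; rewrite lee_fin enorm_ge0.
  rewrite -(fineK (integrable_fin_num measurableT (enorm_integrable PO))).
  rewrite -(fineK (integrable_fin_num measurableT (enorm_integrable muO))).
  by rewrite -!EFinM -EFinD ltry.
exists Q.
  split=> //; apply: (@geometric_quotient_cvg _ _ _ _ e m%:R (2 ^ m) (size l).+1) => //.
    move=> J n Jn; apply: (mixture_quant_error_le e0 e1 s0 s2 r_gt0 QE lnil P0).
      by move=> f mf f0; exact: (muP f mf f0).1.
    exact: leq_trans (add_sum_powers_le _ _ M1) Jn.
  move=> j n nj; apply: (mixture_quant_error_ge e0 e1 s0 r_gt0 QE _ nj).
  by move=> f mf f0; exact: (muP f mf f0).2.
apply: (@le_lt_trans _ _ (eps / 2 + e * K)%:E); last by rewrite lte_fin; lra.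
apply: d_L_le => // h hL.
rewrite (mixture_Lip1 e01 PO muO hL QE).
have /= Pt := Plip h hL.
have Mh := Rintegral_Lip1_near0 muO hL.
have Ph := Rintegral_Lip1_near0 PO hL.
(* The inserted [h 0] cancels; it lets the first moments of [mu] and [P] control the second term. *)
rewrite (_ : _ - _ = (\int[P]_x h x - \int[theta]_x h x) +
  e * (\int[mu]_x h x - h 0 - (\int[P]_x h x - h 0))); last by ring.
rewrite (le_trans (ler_normD _ _))// lerD// normrM (ger0_norm (ltW e0)).
rewrite ler_wpM2l ?(ltW e0)// (le_trans (ler_normB _ _))//.
by rewrite lerD.
Qed.
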